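(* Let $\emptyset\neq\mathcal{P}\subset\mathbb{R}^d$ be a polytope. Then $\mathcal{P}$ is monotone if and only if both of the following hold: (1) $\operatorname{proj}_{\mathcal{P}}(0)\in\operatorname{ri}\mathcal{P}$, and (2) $\operatorname{proj}_{\operatorname{aff}F}(0)\in F$ for each face $\emptyset\neq F\subset\mathcal{P}$ (including $F=\mathcal{P}$).
   Context: Fix an inner product $\langle\cdot,\cdot\rangle$ on $\mathbb{R}^d$ with induced norm $\|\cdot\|$. A polytope is the convex hull of finitely many points. A face of $\mathcal{P}$ is a convex subset $F\subset\mathcal{P}$ such that any open line segment $L=(x,y)\subset\mathcal{P}$ with $L\cap F\neq\emptyset$ satisfies $[x,y]\subset F$; $\mathcal{P}$ itself is a face. $\operatorname{ri}K$ denotes the relative interior of $K$ and $\operatorname{aff}K$ its affine hull. For a nonempty closed convex set $K$, $\operatorname{proj}_K(x)$ is the unique point of $K$ nearest to $x$ in $\|\cdot\|$; in particular $\operatorname{proj}_K(0)$ is the minimum-norm point of $K$. Regularized linear program: for $c\in\mathbb{R}^d$ and $\delta\ge 0$ let $\mathcal{P}(\delta)=\{x\in\mathcal{P}:\|x\|\le\delta\}$, $\delta_{\min}=\min\{\delta\ge0:\mathcal{P}(\delta)\neq\emptyset\}$, $\delta_{\max}=\min\{\delta\ge0:\min_{x\in\mathcal{P}(\delta)}\langle c,x\rangle=\min_{x\in\mathcal{P}}\langle c,x\rangle\}$. For $\delta\in[\delta_{\min},\delta_{\max}]$, $x^\delta$ denotes the unique minimizer of $\langle c,x\rangle$ over $x\in\mathcal{P}(\delta)$.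 For $\eta\in[0,\infty)$ let $x_\eta=\operatorname{proj}_{\mathcal{P}}(-\eta c)$ (for $\eta>0$ this is the unique minimizer of $\langle c,x\rangle+\frac{1}{2\eta}\|x\|^2$ over $\mathcal{P}$), and $x_\infty=\lim_{\eta\to\infty}x_\eta$. The curves $(x^\delta)$ and $(x_\eta)$ are monotone reparametrizations of one another. $\mathcal{P}$ is called $c$-monotone if for any face $F$ of $\mathcal{P}$: $x^\delta\in F$ implies $x^{\delta'}\in F$ for all $\delta'\ge\delta$ in $[\delta_{\min},\delta_{\max}]$; equivalently, $x_\eta\in F$ implies $x_{\eta'}\in F$ for all $\eta'\ge\eta$ in $[0,\infty]$. $\mathcal{P}$ is called monotone if it is $c$-monotone for all $c\in\mathbb{R}^d$. *)

(* Defs.v *)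
From HB Require Import structures.
From mathcomp Require Import all_boot all_order all_algebra.
From mathcomp Require Import mathcomp_extra boolp classical_sets set_interval.
From mathcomp Require Import cardinality reals convex.

Set Implicit Arguments.
Unset Strict Implicit.
Unset Printing Implicit Defensive.

Import Order.TTheory GRing.Theory Num.Theory.

Local Open Scope classical_set_scope.
Local Open Scope ring_scope.

Section ConvexGeometry.
Context {R : realType} {d : nat}.
Implicit Types (A K P F : set 'rV[R]_d) (x y : 'rV[R]_d).

Definition open_segment x y : set 'rV[R]_d :=
  [set (1 - t) *: x + t *: y | t in `]0, 1[%classic].

Definition closed_segment x y : set 'rV[R]_d :=
  [set (1 - t) *: x + t *: y | t in `[0, 1]%classic].

Definition convex_hull A : set 'rV[R]_d :=
  smallest (fun K => @convex_set R 'rV[R]_d K) A.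

Definition affine_set K : Prop :=
  forall x y (t : R), K x -> K y -> K ((1 - t) *: x + t *: y).

Definition affine_hull A : set 'rV[R]_d := smallest affine_set A.

Definition polytope P : Prop :=
  exists2 S : set 'rV[R]_d, finite_set S & P = convex_hull S.

(* The empty set is a face. *)
Definition face P F : Prop :=
  [/\ @convex_set R 'rV[R]_d F, F `<=` P &
      forall x y, open_segment x y `<=` P -> open_segment x y `&` F !=set0 ->
        closed_segment x y `<=` F].

End ConvexGeometry.

Section Minima.
Context {R : realType}.

Definition is_min (A : set R) (m : R) : Prop := A m /\ lbound A m.

(* Junk value 0 when A has no least element. *)
Definition set_min (A : set R) : R := xget 0 (is_min A).

(* Junk value 0 when f has no minimizer on K. *)
Definition argmin {d : nat} (f : 'rV[R]_d -> R) (K : set 'rV[R]_d) : 'rV[R]_d :=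
  xget 0 [set x | K x /\ forall y, K y -> f x <= f y].

End Minima.

Section RegularizedLP.
Context {R : realType} {d : nat}.
Variable ip : {dot 'rV[R]_d for idfun}.
Implicit Types (K P F : set 'rV[R]_d) (x c : 'rV[R]_d) (delta : R).

Definition ipnorm x : R := Num.sqrt (ip x x).

Definition proj K x : 'rV[R]_d := argmin (fun y => ipnorm (y - x)) K.

Definition relint K : set 'rV[R]_d :=
  [set x | K x /\ exists2 e : R, 0 < e &
    forall y, affine_hull K y -> ipnorm (y - x) < e -> K y].

Definition truncation P delta : set 'rV[R]_d :=
  [set x | P x /\ ipnorm x <= delta].

Definition delta_min P : R :=
  set_min [set delta | 0 <= delta /\ truncation P delta !=set0].

(* Stating the equality of minima through a common value m keeps out the delta
   for which the truncation is empty and has no minimum. *)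
Definition delta_max P c : R :=
  set_min [set delta | 0 <= delta /\
    exists m, is_min [set ip c x | x in truncation P delta] m /\
              is_min [set ip c x | x in P] m].

Definition xdelta P c delta : 'rV[R]_d := argmin (ip c) (truncation P delta).

Definition c_monotone P c : Prop :=
  forall F, face P F -> forall delta delta',
    delta_min P <= delta -> delta <= delta' -> delta' <= delta_max P c ->
    F (xdelta P c delta) -> F (xdelta P c delta').

Definition monotone P : Prop := forall c, c_monotone P c.

End RegularizedLP.

(* Main.v *)
(* Let [p] be the minimum-norm point of [P].  If the path is monotone, the
   minimal face of [p] contains the end of every path, that is, a minimizer of
   every linear functional, so it is [P] and [p] is relatively interior.  For a
   face [F] with minimum-norm point [x], the cost [- x] gives a path through
   [x]; it stays in the face of [F] on which [<x, .>] is minimal, yet it ends at a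
   maximizer of [<x, .>] over [P].  So [<x, .>] is constant on [F] and [x] is the
   projection of 0 onto [aff F].

   Conversely, the path is continuous, and points of [P] near [x] have [x] in
   their minimal face.  So it suffices to go from a path point [x0] to a later
   path point [x1] whose minimal face [G] contains [x0].  By (2) the projection
   [q] of 0 onto [aff G] lies in [G], and a homothety centred at [q] shows that
   [x0] is in the open segment from [q] to [x1], so that every face containing
   [x0] contains [x1].  The degenerate case [x0 = q] forces [x0 = p], which lies
   in no proper face by (1). *)

From mathcomp Require Import all_boot all_order all_algebra.
From mathcomp Require Import ring lra.
From mathcomp Require Import boolp classical_sets.
From mathcomp Require Import cardinality reals interval_inference convex.
From mathcomp Require Import topology normedtype derive.
Require Import Defs.

Set Implicit Arguments.
Unset Strict Implicit.
Unset Printing Implicit Defensive.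

Import Order.TTheory GRing.Theory Num.Theory.
Import numFieldNormedType.Exports.

Local Open Scope classical_set_scope.
Local Open Scope ring_scope.

(** * Convexity, faces and polytopes *)

Definition simplex {R : realType} (n : nat) : set 'rV[R]_n :=
  [set l | (forall i, 0 <= l 0 i) /\ \sum_i l 0 i = 1].
Arguments simplex {R} n _.

Section Convexity.
Context {R : realType} {d : nat}.
Implicit Types (K P F S : set 'rV[R]_d) (x y z : 'rV[R]_d) (t : R).

Lemma convex_setP K : @convex_set R 'rV[R]_d K <->
  forall x y t, 0 <= t -> t <= 1 -> K x -> K y -> K ((1 - t) *: x + t *: y).
Proof.
split=> [cK x y t t0 t1 Kx Ky|cK x y l].
  (* [conv] gives the weight to its first argument, hence the swapped endpoints. *)
  have := cK y x (Itv01 t0 t1) (mem_set Ky) (mem_set Kx).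
  by rewrite inE /conv /= addrC.
rewrite !inE => Kx Ky.
have -> : conv l x y =
    (1 - l%:num) *: (y : 'rV[R]_d) + l%:num *: (x : 'rV[R]_d).
  by rewrite addrC.
exact: cK.
Qed.

Lemma convex_comb2 K x y a b : @convex_set R 'rV[R]_d K -> K x -> K y ->
  0 <= a -> 0 <= b -> a + b = 1 -> K (a *: x + b *: y).
Proof.
move=> /convex_setP cK Kx Ky a0 b0 ab1.
have -> : a = 1 - b by rewrite -ab1 addrK.
by apply: cK => //; lra.
Qed.

(** Leaving the weights unnormalized allows induction on [r]. If the total weight is 0, all terms
    vanish and [y] is arbitrary. *)
Lemma convex_weighted_mean K (I : Type) (r : seq I) (a : I -> R)
    (x : I -> 'rV[R]_d) : @convex_set R 'rV[R]_d K ->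
  (forall i, 0 <= a i) -> (forall i, 0 < a i -> K (x i)) ->
  exists y, (0 < \sum_(i <- r) a i -> K y) /\
    \sum_(i <- r) a i *: x i = (\sum_(i <- r) a i) *: y.
Proof.
move=> cK a0 Kx; elim: r => [|i r [y [Ky Ey]]].
  by exists 0; rewrite !big_nil ltxx scaler0.
rewrite !big_cons Ey; set s := \sum_(j <- r) a j.
have s0 : 0 <= s by apply: sumr_ge0.
have [ai0|ai0] := eqVneq (a i) 0.
  by exists y; rewrite ai0 scale0r !add0r.
have aip : 0 < a i by rewrite lt_def ai0 a0.
have [s00|sn0] := eqVneq s 0.
  by exists (x i); split=> [_|]; [exact: Kx|rewrite s00 scale0r !addr0].
have sp : 0 < s by rewrite lt_def sn0.
have asn0 : a i + s != 0 by rewrite gt_eqF ?addr_gt0.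
exists (a i / (a i + s) *: x i + s / (a i + s) *: y); split=> [_|].
  apply: convex_comb2 => //; [exact: Kx|exact: Ky| | |].
  - by rewrite divr_ge0 ?addr_ge0.
  - by rewrite divr_ge0 ?addr_ge0.
  - by rewrite -mulrDl divff.
by rewrite scalerDr !scalerA ![_ * (_ / _)]mulrC !divfK.
Qed.

Lemma convex_sum K (n : nat) (a : 'I_n -> R)
    (x : 'I_n -> 'rV[R]_d) : @convex_set R 'rV[R]_d K ->
  (forall i, 0 <= a i) -> \sum_i a i = 1 -> (forall i, 0 < a i -> K (x i)) ->
  K (\sum_i a i *: x i).
Proof.
move=> cK a0 a1 Kx.
have [y [Ky ->]] := convex_weighted_mean (index_enum 'I_n) cK a0 Kx.
by rewrite a1 scale1r; apply: Ky; rewrite a1 ltr01.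
Qed.

Lemma convex_hull_convex S : @convex_set R 'rV[R]_d (convex_hull S).
Proof.
apply/convex_setP => x y t t0 t1 hx hy K [cK SK].
by move/convex_setP: (cK); apply=> //; [apply: hx|apply: hy].
Qed.

Lemma convex_hull_rows n (V : 'M[R]_(n, d)) :
  convex_hull [set row i V | i in setT] = [set l *m V | l in simplex n].
Proof.
apply/seteqP; split=> [x|_ [l [l0 l1] <-] K [cK SK]]; last first.
  rewrite mulmx_sum_row; apply: convex_sum => // i _.
  by apply: SK; exists i.
apply; split; last first.
  move=> _ [i _ <-]; exists (delta_mx 0 i); last by rewrite rowE.
  split=> [j|]; first by rewrite mxE ler0n.
  rewrite (bigD1 i) //= mxE !eqxx big1 ?addr0// => j ji.
  by rewrite mxE (negbTE ji) andbF.
apply/convex_setP => _ _ t t0 t1 [l [l0 l1] <-] [m [m0 m1] <-].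
exists ((1 - t) *: l + t *: m); last by rewrite mulmxDl -!scalemxAl.
split=> [i|].
  by rewrite !mxE addr_ge0 ?mulr_ge0 ?subr_ge0.
under eq_bigr do rewrite !mxE.
by rewrite big_split /= -!mulr_sumr l1 m1; ring.
Qed.

(** Barycentric coordinates present [P] as a linear image of a compact simplex; minimizers are found
    there. *)
Lemma polytope_rows P : polytope P ->
  exists n (V : 'M[R]_(n, d)), P = [set l *m V | l in simplex n].
Proof.
move=> [S /finite_seqP[s ->] ->].
exists (size s), (\matrix_(i < size s) s`_i); rewrite -convex_hull_rows.
congr convex_hull; apply/seteqP; split=> [x /= /(nthP 0)[i ilt <-]|_ [i _ <-]].
  by exists (Ordinal ilt); rewrite // rowK.
by rewrite rowK /= mem_nth.
Qed.

Lemma polytope_convex P : polytope P -> @convex_set R 'rV[R]_d P.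
Proof. by move=> [S _ ->]; exact: convex_hull_convex. Qed.

Lemma face_sub P F x : face P F -> F x -> P x.
Proof. by move=> [_ + _]; apply. Qed.

Lemma face_trans P F G : face P F -> face F G -> face P G.
Proof.
move=> [cF FP fF] [cG GF fG]; split=> //; first exact: subset_trans FP.
move=> x y xyP [z [xyz Gz]]; apply: fG; last by exists z.
have xyF : closed_segment x y `<=` F.
  by apply: fF => //; exists z; split=> //; exact: GF.
move=> w [t]; rewrite /= in_itv/= => /andP[t0 t1] <-.
by apply: xyF; exists t => //; rewrite /= in_itv/= !ltW.
Qed.

Lemma closed_segment_l x y : closed_segment x y x.
Proof.
exists 0; first by rewrite /= in_itv/= lexx ler01.
by rewrite subr0 scale1r scale0r addr0.
Qed.

Lemma closed_segment_r x y : closed_segment x y y.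
Proof.
exists 1; first by rewrite /= in_itv/= lexx ler01.
by rewrite subrr scale1r scale0r add0r.
Qed.

Lemma face_endpoints P F x y t : @convex_set R 'rV[R]_d P -> face P F ->
  P x -> P y -> 0 < t -> t < 1 -> F ((1 - t) *: x + t *: y) -> F x /\ F y.
Proof.
move=> cP [_ _ fF] Px Py t0 t1 Fxy.
have xyF : closed_segment x y `<=` F.
  apply: fF; last first.
    exists ((1 - t) *: x + t *: y); split=> //.
    by exists t; rewrite //= in_itv/= t0.
  move=> w [u]; rewrite /= in_itv/= => /andP[u0 u1] <-.
  by move/convex_setP: cP; apply=> //; exact: ltW.
by split; apply: xyF; [exact: closed_segment_l|exact: closed_segment_r].
Qed.

(** If [row i V] has weight strictly between 0 and 1 in a point [y] of [F], then [y] lies strictly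
    between that row and the weighted mean [z] of the others, so the row is in [F]. In particular
    [P] has finitely many faces. *)
Lemma face_rows n (V : 'M[R]_(n, d)) P F : P = [set l *m V | l in simplex n] ->
  face P F -> F = convex_hull [set row i V | i in [set i | F (row i V)]].
Proof.
move=> PE fF; have [cF FP _] := fF.
apply/seteqP; split=> [y Fy|y]; last first.
  by apply; split=> // _ [i Fi <-].
have := FP _ Fy; rewrite {1}PE => -[l [l0 l1] Ey] K [cK SK].
rewrite -Ey mulmx_sum_row; apply: convex_sum => // i lip.
apply: SK; exists i => //=.
have lD : l 0 i + \sum_(j | j != i) l 0 j = 1.
  by rewrite -[RHS]l1 [RHS](bigD1 i).
have cP : @convex_set R 'rV[R]_d P.
  by rewrite PE -convex_hull_rows; exact: convex_hull_convex.
have PV j : P (row j V).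
  by rewrite PE -convex_hull_rows => L [_]; apply; exists j.
pose a j := if j == i then 0 else l 0 j.
have a0 j : 0 <= a j by rewrite /a; case: eqP.
have [z [Pz Ez]] :=
  convex_weighted_mean (index_enum 'I_n) cP a0 (fun j _ => PV j).
have aE : \sum_j a j = 1 - l 0 i.
  rewrite -lD addrAC subrr add0r [LHS](bigD1 i) //= /a eqxx add0r.
  by apply: eq_bigr => j /negbTE ->.
have yE : y = (1 - l 0 i) *: z + l 0 i *: row i V.
  rewrite -Ey mulmx_sum_row (bigD1 i) //= addrC -aE -Ez; congr (_ + _).
  rewrite [RHS](bigD1 i) //= /a eqxx scale0r add0r.
  by apply: eq_bigr => j /negbTE ->.
have [li1|li1] := eqVneq (l 0 i) 1.
  by move: Fy; rewrite yE li1 subrr scale0r scale1r add0r.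
have li_lt1 : l 0 i < 1.
  by rewrite lt_neqAle li1 -lD lerDl sumr_ge0.
rewrite yE in Fy; apply: proj2 (face_endpoints cP fF _ (PV i) lip li_lt1 Fy).
by apply: Pz; rewrite aE subr_gt0.
Qed.

Lemma face_polytope P F : polytope P -> face P F -> polytope F.
Proof.
move=> /polytope_rows[n [V PE]] fF.
exists [set row i V | i in [set i | F (row i V)]]; last exact: face_rows fF.
exact/finite_image/finite_finset.
Qed.

(** The points from which the segment to [x] can be prolonged beyond [x] inside [P]. For a point [x]
    of a polytope this is the smallest face containing [x]. *)
Definition min_face P x : set 'rV[R]_d :=
  [set z | P z /\ exists2 e : R, 0 < e & P (x + e *: (x - z))].

Lemma min_face_self P x : P x -> min_face P x x.
Proof. by move=> Px; split=> //; exists 1; rewrite // subrr scaler0 addr0. Qed.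

Lemma min_face_shrink P x z e e' : @convex_set R 'rV[R]_d P -> P x ->
  P (x + e *: (x - z)) -> 0 <= e' -> e' <= e -> P (x + e' *: (x - z)).
Proof.
move=> cP Px Pe e'0 e'e.
have [e0|e0] := eqVneq e 0.
  by have -> : e' = e by lra.
have ep : 0 < e by rewrite lt_def e0; lra.
have -> : x + e' *: (x - z) =
    (1 - e' / e) *: x + (e' / e) *: (x + e *: (x - z)).
  apply/rowP => i; rewrite !mxE; field; exact: e0.
move/convex_setP: cP; apply=> //; first by rewrite divr_ge0 // ltW.
by rewrite ler_pdivrMr // mul1r.
Qed.

(** [x] lies strictly between [z] and the prolonged point, at parameter [1 / (1 + e)]. *)
Lemma min_face_sub P F x : @convex_set R 'rV[R]_d P -> face P F -> F x ->
  min_face P x `<=` F.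
Proof.
move=> cP fF Fx z [Pz [e e0 Pe]].
apply: (proj1 (@face_endpoints P F z _ (1 / (1 + e)) cP fF Pz Pe _ _ _)).
- by rewrite divr_gt0 // addr_gt0.
- by rewrite ltr_pdivrMr ?mul1r; lra.
- have -> // : (1 - 1 / (1 + e)) *: z + (1 / (1 + e)) *: (x + e *: (x - z)) = x.
  by apply/rowP => i; rewrite !mxE; field; rewrite gt_eqF// addr_gt0.
Qed.

(** A face is tested on open segments in [P], so their endpoints must be known to lie in [P]; for
    polytopes this comes from closedness. *)
Lemma face_min_face P x : @convex_set R 'rV[R]_d P ->
  (forall u v, open_segment u v `<=` P -> P u /\ P v) -> P x ->
  face P (min_face P x).
Proof.
move=> cP endP Px.
have cM : @convex_set R 'rV[R]_d (min_face P x).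
  apply/convex_setP => u v t t0 t1 [Pu [e e0 Pe]] [Pv [f f0 Pf]].
  split; first by move/convex_setP: cP; apply.
  have m0 : 0 < Num.min e f by rewrite lt_min e0.
  exists (Num.min e f) => //.
  have -> : x + Num.min e f *: (x - ((1 - t) *: u + t *: v)) =
      (1 - t) *: (x + Num.min e f *: (x - u)) +
      t *: (x + Num.min e f *: (x - v)).
    by apply/rowP => i; rewrite !mxE; ring.
  move/convex_setP: (cP); apply=> //.
    by apply: (min_face_shrink cP Px Pe); rewrite ?(ltW m0) ?ge_min ?lexx.
  by apply: (min_face_shrink cP Px Pf); rewrite ?(ltW m0) ?ge_min ?lexx ?orbT.
split=> [//|z [] //|u v uvP [y [[t]]]].
rewrite /= in_itv/= => /andP[t0 t1] <- [_ [e e0 Pe]].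
have [Pu Pv] := endP _ _ uvP.
have key a b s : P a -> P b -> 0 < s -> s < 1 ->
    P (x + e *: (x - ((1 - s) *: a + s *: b))) -> min_face P x a.
  move=> Pa Pb s0 s1 Ps; split=> //.
  have es : 0 < e * s by rewrite mulr_gt0.
  have es1 : 0 < 1 + e * s by lra.
  (* This is where the ray from [a] through [x] meets the segment from the prolonged point to
     [b]. *)
  exists (e * (1 - s) / (1 + e * s)).
    by rewrite divr_gt0 ?mulr_gt0 ?subr_gt0.
  have -> : x + (e * (1 - s) / (1 + e * s)) *: (x - a) =
      (1 - (e * s) / (1 + e * s)) *: (x + e *: (x - ((1 - s) *: a + s *: b))) +
      ((e * s) / (1 + e * s)) *: b.
    by apply/rowP => i; rewrite !mxE; field; rewrite gt_eqF.
  move/convex_setP: cP; apply=> //; first by rewrite divr_ge0 ?ltW.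
  by rewrite ler_pdivrMr // mul1r; lra.
have Mu : min_face P x u by exact: (key u v t).
have Mv : min_face P x v.
  apply: (key v u (1 - t)) => //; rewrite ?subr_gt0 // ?ltrBlDr ?ltrDl //.
  by rewrite subKr [t *: v + _]addrC.
move=> w [s]; rewrite /= in_itv/= => /andP[s0 s1] <-.
by move/convex_setP: cM; apply.
Qed.

End Convexity.

(** * Inner product and compactness *)

Section InnerProduct.
Context {R : realType} {d : nat}.
Variable ip : {dot 'rV[R]_d for idfun}.
Implicit Types (K P F S : set 'rV[R]_d) (x y z u v c : 'rV[R]_d) (t : R).

Lemma ipC x y : ip x y = ip y x.
Proof. by rewrite hermC /= expr0 mul1r. Qed.

Lemma ipDl x y z : ip (x + y) z = ip x z + ip y z.
Proof. exact: linearDl. Qed.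
Lemma ipDr x y z : ip z (x + y) = ip z x + ip z y.
Proof. exact: linearDr. Qed.
Lemma ipZl t x z : ip (t *: x) z = t * ip x z.
Proof. exact: linearZl_LR. Qed.
Lemma ipZr t x z : ip z (t *: x) = t * ip z x.
Proof. by rewrite ipC ipZl ipC. Qed.
Lemma ipNl x z : ip (- x) z = - ip x z.
Proof. by rewrite -scaleN1r ipZl mulN1r. Qed.
Lemma ipNr x z : ip z (- x) = - ip z x.
Proof. by rewrite ipC ipNl ipC. Qed.
Lemma ip0l z : ip 0 z = 0.
Proof. by rewrite -(scale0r 0) ipZl mul0r. Qed.
Lemma ip0r z : ip z 0 = 0.
Proof. by rewrite ipC ip0l. Qed.

Definition ipE := (ipDl, ipDr, ipZl, ipZr, ipNl, ipNr, ip0l, ip0r).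

Lemma ip_addZ x u t : ip (x + t *: u) (x + t *: u) =
  ip x x + 2 * t * ip x u + t ^+ 2 * ip u u.
Proof. by rewrite !ipE (ipC u x); ring. Qed.

Lemma ip_suml (I : Type) (r : seq I) (f : I -> 'rV[R]_d) z :
  ip (\sum_(i <- r) f i) z = \sum_(i <- r) ip (f i) z.
Proof.
by elim: r => [|i r IH]; rewrite ?big_nil ?ip0l// !big_cons ipDl IH.
Qed.

Lemma ip_ge0 x : 0 <= ip x x.
Proof.
by have [->|x0] := eqVneq x 0; rewrite ?ip0l// ltW// neq0_dnorm_gt0.
Qed.

Lemma ip_eq0 x : ip x x = 0 -> x = 0.
Proof.
have [//|x0] := eqVneq x 0; have := @neq0_dnorm_gt0 _ _ _ ip _ x0.
by move=> /gt_eqF/eqP.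
Qed.

Lemma ip_sub_eq0 x y : ip (x - y) (x - y) <= 0 -> x = y.
Proof.
move=> xy; apply/subr0_eq/ip_eq0/eqP.
by rewrite eq_le xy ip_ge0.
Qed.

Lemma ipnorm_ge0 x : 0 <= ipnorm ip x. Proof. exact: sqrtr_ge0. Qed.

Lemma sqr_ipnorm x : ipnorm ip x ^+ 2 = ip x x.
Proof. by rewrite sqr_sqrtr // ip_ge0. Qed.

Lemma ler_ipnorm x y : (ipnorm ip x <= ipnorm ip y) = (ip x x <= ip y y).
Proof. by rewrite ler_sqrt // ip_ge0. Qed.

Lemma ipnorm_le x t : 0 <= t -> (ipnorm ip x <= t) = (ip x x <= t ^+ 2).
Proof. by move=> t0; rewrite -sqr_ipnorm ler_sqr ?nnegrE ?ipnorm_ge0. Qed.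

Lemma ipnorm_lt x t : 0 <= t -> (ipnorm ip x < t) = (ip x x < t ^+ 2).
Proof. by move=> t0; rewrite -sqr_ipnorm ltr_sqr ?nnegrE ?ipnorm_ge0. Qed.

Lemma cauchy_schwarz x y : `|ip x y| <= ipnorm ip x * ipnorm ip y.
Proof.
rewrite -ler_sqr ?nnegrE ?mulr_ge0 ?ipnorm_ge0//.
rewrite exprMn !sqr_ipnorm -normrX ger0_norm ?sqr_ge0//.
have [->|x0] := eqVneq x 0; first by rewrite !ip0l expr0n mul0r.
have xx0 := @neq0_dnorm_gt0 _ _ _ ip _ x0.
have := ip_ge0 (ip x x *: y - ip x y *: x).
rewrite !ipE (ipC y x) => h.
have {h} : 0 <= ip x x * (ip x x * ip y y - ip x y ^+ 2) by nra.
by rewrite pmulr_rge0 // subr_ge0.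
Qed.

(* The coefficients of the orthogonal projection onto the span of [u] are
   represented by the vectors [g i] (Gram-Schmidt), so that every vector of the
   span has coefficients controlled by its norm. *)
Lemma orthogonal_projection_coeffs n (u : nat -> 'rV[R]_d) :
  exists g : nat -> 'rV[R]_d, forall v j, (j < n)%N ->
    ip (v - \sum_(i < n) ip v (g i) *: u i) (u j) = 0.
Proof.
elim: n => [|n [g gP]]; first by exists (fun=> 0).
pose pr v := \sum_(i < n) ip v (g i) *: u i.
have [r rE] : exists r, r = u n - pr (u n) by eexists.
have prP v w : ip (v - pr v) (pr w) = 0.
  rewrite ipC ip_suml big1 // => i _.
  by rewrite ipZl [ip (u i) _]ipC gP // mulr0.
have uE : u n = r + pr (u n) by rewrite rE subrK.
(* If [r = 0], then [a = 0] and [u n] receives the coefficient 0. *)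
pose a : R := (ip r r)^-1.
(* The new term is a multiple of [r = u n - pr (u n)]; its second half is absorbed into the earlier
   coefficients. *)
pose g' i := if (i < n)%N then g i - (a * ip (u n) (g i)) *: r else a *: r.
have g'E v : \sum_(i < n.+1) ip v (g' i) *: u i = pr v + (a * ip v r) *: r.
  rewrite big_ord_recr /= {2}/g' ltnn ipE.
  have -> : \sum_(i < n) ip v (g' i) *: u i = pr v - (a * ip v r) *: pr (u n).
    rewrite /pr scaler_sumr -sumrB; apply: eq_bigr => i _.
    by rewrite /g' ltn_ord !ipE scalerA -scalerBl; congr (_ *: _); ring.
  by rewrite rE scalerBr -addrA [- _ + _]addrC.
exists g' => v j; rewrite g'E ltnS leq_eqVlt => /orP[/eqP ->|jn].
  have rr : a * ip v r * ip r r = ip v r.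
    have [->|r0] := eqVneq r 0; first by rewrite !ip0r mulr0.
    by rewrite /a; field; rewrite gt_eqF // (@neq0_dnorm_gt0 _ _ _ ip _ r0).
  have h1 : ip r (pr (u n)) = 0 by rewrite rE; exact: prP.
  have h2 : ip (pr v) r = 0 by rewrite ipC rE; exact: prP.
  have := prP v (u n); rewrite [X in _ -> ip _ X = _]uE.
  by rewrite !(ipDl, ipDr, ipNl, ipNr, ipZl) h1 h2 rr; lra.
have h1 : ip r (u j) = 0 by rewrite rE; exact: gP.
rewrite opprD addrA ipDl [ip (v - pr v) _]gP //.
by rewrite ipNl ipZl h1 mulr0 oppr0 addr0.
Qed.

Lemma closed_le_continuous n (f : 'rV[R]_n -> R) a :
  continuous f -> closed [set l | f l <= a].
Proof.
move=> cf; have -> : [set l | f l <= a] = f @^-1` [set y | y <= a] by [].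
apply: preimage_closed; last exact: closed_le.
by move=> x _; exact: cf.
Qed.

Lemma continuous_sum_rV n k (f : 'I_k -> 'rV[R]_n -> R) :
  (forall i, continuous (f i)) -> continuous (fun l => \sum_i f i l).
Proof.
move=> cf; apply: continuous_big => [|i _]; last exact: cf.
exact: add_continuous.
Qed.

Lemma continuous_mul_rV n (f g : 'rV[R]_n -> R) :
  continuous f -> continuous g -> continuous (fun l => f l * g l).
Proof. by move=> cf cg l; exact: (cvgM (cf l) (cg l)). Qed.

Lemma continuous_ip_mulmx n (V : 'M[R]_(n, d)) c :
  continuous (fun l : 'rV[R]_n => ip c (l *m V)).
Proof.
have -> : (fun l : 'rV[R]_n => ip c (l *m V)) =
    (fun l => \sum_i l 0 i * ip c (row i V)).
  apply/funext => l; rewrite mulmx_sum_row ipC ip_suml.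
  by apply: eq_bigr => i _; rewrite ipZl ipC.
apply: continuous_sum_rV => i; apply: continuous_mul_rV.
  exact: coord_continuous.
exact: cst_continuous.
Qed.

Lemma continuous_ip2_mulmx n (V : 'M[R]_(n, d)) :
  continuous (fun l : 'rV[R]_n => ip (l *m V) (l *m V)).
Proof.
have -> : (fun l : 'rV[R]_n => ip (l *m V) (l *m V)) =
    (fun l => \sum_i l 0 i * ip (row i V) (l *m V)).
  apply/funext => l; rewrite {1}mulmx_sum_row ip_suml.
  by apply: eq_bigr => i _; rewrite ipZl.
apply: continuous_sum_rV => i; apply: continuous_mul_rV.
  exact: coord_continuous.
exact: continuous_ip_mulmx.
Qed.

Lemma simplex_compact n : compact (@simplex R n).
Proof.
apply: bounded_closed_compact.
  exists 1; split; first exact: num_real.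
  move=> M M1 l [l0 l1] /=; rewrite /Num.norm /= mx_normrE.
  apply: bigmax_le => [|[i j] _] /=; first by rewrite ltW // (lt_trans _ M1).
  rewrite ord1 ger0_norm // (le_trans _ (ltW M1)) // -l1 (bigD1 j) //= lerDl.
  exact: sumr_ge0.
have -> : @simplex R n =
    \bigcap_(i in setT) [set l | - (l 0 i) <= 0] `&`
    ([set l | \sum_i l 0 i <= 1] `&` [set l | \sum_i - l 0 i <= -1]).
  apply/seteqP; split=> l [] /=.
    move=> l0 l1; split; first by move=> i _ /=; rewrite oppr_le0.
    by rewrite sumrN l1 !lexx.
  move=> l0 [l1]; rewrite sumrN lerN2 => l1'.
  by split=> [i|]; [rewrite -oppr_le0; exact: l0|apply/eqP; rewrite eq_le l1].
apply: closedI.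
  apply: closed_bigI => i _; apply: closed_le_continuous => l.
  exact: (cvgN (coord_continuous (x := l))).
apply: closedI; apply: closed_le_continuous; apply: continuous_sum_rV => i.
  exact: coord_continuous.
move=> l; exact: (cvgN (coord_continuous (x := l))).
Qed.

(** One existence result for every minimization below: nearest points, linear programs, linear
    programs on a ball ([m = 1], [a = delta ^+ 2]), and the least norm among solutions of a linear
    program. *)
Lemma polytope_min_quadratic P u k v m a : polytope P ->
  (exists x, P x /\ ip v x + m * ip x x <= a) ->
  exists x, [/\ P x, ip v x + m * ip x x <= a & forall y, P y ->
    ip v y + m * ip y y <= a -> ip u x + k * ip x x <= ip u y + k * ip y y].
Proof.
move=> /polytope_rows[n [V ->]] [_ [[l0 sl0 <-] l0a]].
pose f w (b : R) (l : 'rV[R]_n) := ip w (l *m V) + b * ip (l *m V) (l *m V).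
have cf w b : continuous (f w b).
  have cb : continuous (fun l : 'rV[R]_n => b * ip (l *m V) (l *m V)).
    apply: continuous_mul_rV; first exact: cst_continuous.
    exact: continuous_ip2_mulmx.
  by move=> l; exact: (cvgD (@continuous_ip_mulmx n V w l) (cb l)).
pose A := @simplex R n `&` [set l | f v m l <= a].
have cA : compact A.
  apply: compact_closedI; first exact: simplex_compact.
  exact: closed_le_continuous.
have [|||l lA lmin] := @EVT_min_rV R n (f u k) A; [by exists l0|by []| |].
  exact: continuous_subspaceT.
move: lA; rewrite inE => -[sl la]; exists (l *m V); split=> //.
  by exists l.
by move=> _ [l' sl' <-] la'; apply: lmin; rewrite inE.
Qed.

End InnerProduct.

(** * Nearest points and relative interior *)

Section Nearest.
Context {R : realType} {d : nat}.
Variable ip : {dot 'rV[R]_d for idfun}.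
Implicit Types (K P F S : set 'rV[R]_d) (x y z u v c : 'rV[R]_d) (t : R).

Lemma ge0_of_quadratic (a b : R) : 0 <= b ->
  (forall t, 0 < t -> t <= 1 -> 0 <= 2 * t * a + t ^+ 2 * b) -> 0 <= a.
Proof.
move=> b0 h; rewrite leNgt; apply/negP => a0.
have ba : 0 < b - a by lra.
(* With this step [t * b < - a], so [2 * a + t * b < a < 0]. *)
have t0 : 0 < - a / (b - a) by rewrite divr_gt0 ?oppr_gt0.
have t1 : - a / (b - a) <= 1 by rewrite ler_pdivrMr // mul1r; lra.
have := h _ t0 t1; set t := - a / (b - a) in t0 *.
have tE : t * (b - a) = - a by rewrite /t divfK ?gt_eqF.
have -> : 2 * t * a + t ^+ 2 * b = t * (2 * a + t * b) by ring.
by rewrite pmulr_rge0 //; nra.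
Qed.

Lemma polytope_nearest P z : polytope P -> P !=set0 ->
  exists2 x, P x & forall y, P y -> ip (x - z) (x - z) <= ip (y - z) (y - z).
Proof.
move=> polyP [x0 Px0].
have [|x [Px _ xmin]] :=
  (* Up to the constant [ip z z] the objective is the squared distance to [z]; the constraint reads
     [0 <= 0]. *)
  @polytope_min_quadratic R d ip P (- 2 *: z) 1 0 0 0 polyP.
  by exists x0; rewrite !ipE mul0r addr0.
exists x => // y Py; have := xmin y Py; rewrite !ipE (ipC ip _ z) (ipC ip y z).
move=> h; have {h} := h ltac:(by rewrite mul0r addr0); lra.
Qed.

(** Variational inequality of the projection: the first-order change of the squared distance to [z]
    from [x] towards [y] cannot be negative. *)
Lemma nearest_ip_ge0 K x z y : @convex_set R 'rV[R]_d K -> K x ->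
  (forall y, K y -> ip (x - z) (x - z) <= ip (y - z) (y - z)) ->
  K y -> 0 <= ip (x - z) (y - x).
Proof.
move=> /convex_setP cK Kx xmin Ky.
apply: (ge0_of_quadratic (ip_ge0 ip (y - x))).
move=> t t0 t1; have := xmin _ (cK _ _ _ (ltW t0) t1 Kx Ky).
have -> : (1 - t) *: x + t *: y - z = (x - z) + t *: (y - x).
  by apply/rowP => i; rewrite !mxE; ring.
by rewrite ip_addZ; lra.
Qed.

(** A form of closedness: if the point [p] of [P] nearest to [x] were not [x], points of the segment
    close to [x] would be nearer than [p]. *)
Lemma polytope_open_segment P x y : polytope P ->
  open_segment x y `<=` P -> P x.
Proof.
move=> polyP xyP.
have PI t : 0 < t -> t < 1 -> P ((1 - t) *: x + t *: y).
  by move=> t0 t1; apply: xyP; exists t; rewrite //= in_itv/= t0.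
have P0 : P !=set0 by exists ((1 - 2^-1) *: x + 2^-1 *: y); apply: PI; lra.
have [p Pp pmin] := polytope_nearest x polyP P0.
suff -> : x = p by [].
apply/esym/(@ip_sub_eq0 _ _ ip); rewrite leNgt; apply/negP => px0.
pose b := ip (y - x) (y - x); have b0 : 0 <= b := ip_ge0 ip _.
set a := ip (p - x) (p - x) in px0.
have t0 : 0 < a / (2 * (a + b + 1)) by rewrite divr_gt0 //; lra.
have t1 : a / (2 * (a + b + 1)) < 1 by rewrite ltr_pdivrMr; lra.
have := pmin _ (PI _ t0 t1); rewrite -/a.
set t := a / _ in t0 t1 *.
have tE : t * (2 * (a + b + 1)) = a by rewrite /t divfK // gt_eqF //; lra.
have -> : (1 - t) *: x + t *: y - x = t *: (y - x).
  by apply/rowP => i; rewrite !mxE; ring.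
rewrite ipZl ipZr -/b.
have : t * b <= a by nra.
have : 0 < t * a by rewrite mulr_gt0.
nra.
Qed.

Lemma polytope_endpoints P x y : polytope P ->
  open_segment x y `<=` P -> P x /\ P y.
Proof.
move=> polyP xyP; split; first exact: polytope_open_segment xyP.
apply: (@polytope_open_segment _ _ x polyP) => z [t].
rewrite /= in_itv/= => /andP[t0 t1] <-; apply: xyP; exists (1 - t).
  by rewrite /= in_itv/=; apply/andP; split; lra.
by rewrite subKr addrC.
Qed.

Lemma polytope_min_face P x : polytope P -> P x -> face P (min_face P x).
Proof.
move=> polyP; apply: face_min_face; first exact: polytope_convex.
by move=> u v; exact: polytope_endpoints.
Qed.

(** Inside a segment the value is a positive combination of two nonnegative end values, so it
    vanishes only if both do. *)
Lemma face_argmin F c x : @convex_set R 'rV[R]_d F ->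
  (forall u v, open_segment u v `<=` F -> F u /\ F v) ->
  (forall y, F y -> 0 <= ip c (y - x)) ->
  face F [set y | F y /\ ip c (y - x) = 0].
Proof.
move=> cF endF c0.
have cH : @convex_set R 'rV[R]_d [set y | F y /\ ip c (y - x) = 0].
  apply/convex_setP => u v t t0 t1 [Fu u0] [Fv v0].
  split; first by move/convex_setP: cF; apply.
  by move: u0 v0; rewrite !ipE => u0 v0; nra.
split=> [//|y []//|u v uvF [y [[t]]]].
rewrite /= in_itv/= => /andP[t0 t1] <- [_ y0].
have [Fu Fv] := endF _ _ uvF.
have := c0 _ Fu; have := c0 _ Fv => cv cu.
have cuv : (1 - t) * ip c (u - x) + t * ip c (v - x) = 0.
  by move: y0; rewrite !ipE; lra.
have tu : 0 <= (1 - t) * ip c (u - x) by rewrite mulr_ge0 // subr_ge0 ltW.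
have tv : 0 <= t * ip c (v - x) by rewrite mulr_ge0 // ltW.
have u0 : ip c (u - x) = 0.
  have /eqP : (1 - t) * ip c (u - x) = 0 by lra.
  by rewrite mulf_eq0 subr_eq0 gt_eqF //= => /eqP.
have v0 : ip c (v - x) = 0.
  have /eqP : t * ip c (v - x) = 0 by lra.
  by rewrite mulf_eq0 gt_eqF //= => /eqP.
move=> w [s]; rewrite /= in_itv/= => /andP[s0 s1] <-.
by move/convex_setP: cH; apply.
Qed.

(** Every face is the hull of some of the finitely many generators. A hull that misses [x] is at
    positive distance from it, and [r] bounds all these squared distances from below. *)
Lemma face_nearby P x : polytope P -> exists2 r, 0 < r &
  forall F y, face P F -> F y -> ip (y - x) (y - x) < r -> F x.
Proof.
move=> /polytope_rows[n [V PE]].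
pose H (A : {set 'I_n}) := convex_hull [set row i V | i in [set i | i \in A]].
have polyH A : polytope (H A).
  by exists [set row i V | i in [set i | i \in A]] => //;
    exact/finite_image/finite_finset.
have rP A : exists r, 0 < r /\
    forall y, H A y -> ip (y - x) (y - x) < r -> H A x.
  have [HA0|HA0] := pselect (H A !=set0); last first.
    by exists 1; split=> // y Hy; case: HA0; exists y.
  have [p Hp pmin] := polytope_nearest x (polyH A) HA0.
  have [px0|px0] := leP (ip (p - x) (p - x)) 0.
    by exists 1; split=> // *; rewrite -(ip_sub_eq0 px0).
  exists (ip (p - x) (p - x)); split=> // y /pmin.
  by rewrite leNgt => /negbTE ->.
have [r rHP] := choice rP.
exists (\big[Num.min/1]_A r A).
  by apply: lt_bigmin => // A _; have [] := rHP A.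
move=> F y fF Fy yr.
have FE : F = H [set i | `[< F (row i V) >]]%SET.
  rewrite {1}(face_rows PE fF) /H; congr convex_hull; apply/seteqP.
  by split=> _ [i Fi <-]; exists i => //; move: Fi; rewrite /= inE => /asboolP.
rewrite FE; apply: (proj2 (rHP _) y); first by rewrite -FE.
exact: lt_le_trans yr (bigmin_le _ _ _).
Qed.

Lemma affine_hull_ip_eq0 F x y :
  (forall z, F z -> ip x (z - x) = 0) -> affine_hull F y -> ip x (y - x) = 0.
Proof.
move=> x0 /(_ [set z | ip x (z - x) = 0]); apply; split=> // u v t /=.
by rewrite !ipE => u0 v0; nra.
Qed.

Lemma sub_affine_hull K x : K x -> affine_hull K x.
Proof. by move=> Kx L [_]; apply. Qed.

Lemma affine_hull_affine K : affine_set (affine_hull K).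
Proof.
move=> x y t Kx Ky L [aL KL].
by apply: (aL); [exact: Kx|exact: Ky].
Qed.

Lemma affine_hull_seq (s : seq 'rV[R]_d) y : affine_hull [set` s] y ->
  exists (a : nat -> R), \sum_(i < size s) a i = 1 /\
    y = \sum_(i < size s) a i *: s`_i.
Proof.
move/(_ [set x | exists a : nat -> R, \sum_(i < size s) a i = 1 /\
  x = \sum_(i < size s) a i *: s`_i]); apply.
split=> [u v t [a [a1 ->]] [b [b1 ->]]|x /= /(nthP 0)[k ks <-]].
  exists (fun i => (1 - t) * a i + t * b i); split.
    by rewrite big_split /= -!mulr_sumr a1 b1; ring.
  rewrite !scaler_sumr -big_split; apply: eq_bigr => i _ /=.
  by rewrite [RHS]scalerDl !scalerA.
exists (fun i => (i == k)%:R).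
have kE (i : 'I_(size s)) : i != Ordinal ks -> (i == k :> nat)%:R = 0 :> R.
  by rewrite -val_eqE /= => /negbTE ->.
split; first by rewrite (bigD1 (Ordinal ks)) //= eqxx big1 ?addr0.
rewrite (bigD1 (Ordinal ks)) //= eqxx scale1r big1 ?addr0 // => i /kE ->.
by rewrite scale0r.
Qed.

Lemma affine_hull_convex_hull S :
  affine_hull (convex_hull S) `<=` affine_hull S.
Proof.
move=> x; apply; split; first exact: affine_hull_affine.
move=> y /(_ (affine_hull S)); apply; split; last first.
  by move=> z; exact: sub_affine_hull.
by apply/convex_setP => u v t _ _; exact: affine_hull_affine.
Qed.

Lemma convex_absorb K p n (a : 'I_n -> R) (w : 'I_n -> 'rV[R]_d) :
  @convex_set R 'rV[R]_d K -> K p -> (forall i, K (p + w i)) ->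
  (forall i, 0 <= a i) -> \sum_i a i <= 1 -> K (p + \sum_i a i *: w i).
Proof.
move=> cK Kp Kw a0 a1; set s := \sum_i a i in a1.
have s0 : 0 <= s by exact: sumr_ge0.
have [y [Ky Ey]] :=
  convex_weighted_mean (index_enum 'I_n) cK a0 (fun i _ => Kw i).
have -> : p + \sum_i a i *: w i = (1 - s) *: p + s *: y.
  rewrite -[s *: y]Ey; under [in RHS]eq_bigr do rewrite scalerDr.
  (* The missing weight [1 - s] goes to [p]. *)
  by rewrite big_split /= -scaler_suml addrA -scalerDl subrK scale1r.
have [->|sn0] := eqVneq s 0; first by rewrite subr0 scale1r scale0r addr0.
by move/convex_setP: cK; apply=> //; apply: Ky; rewrite lt_def sn0.
Qed.

(* A point [p] from which every segment of [P] can be prolonged is a relative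
   interior point: the vectors [s_k - p] span the directions of [P], small
   directions have small coefficients on them, and [P] contains [p] translated
   by small multiples of [+-(s_k - p)]. *)
Lemma relint_min_face P p : polytope P -> P p ->
  (forall z, P z -> min_face P p z) -> relint ip P p.
Proof.
move=> polyP Pp Pmin; split=> //; have cP := polytope_convex polyP.
have [_ /finite_seqP[s ->] PE] := polyP.
pose u k := s`_k - p.
have [g gP] := orthogonal_projection_coeffs ip (size s) u.
have Ps (k : 'I_(size s)) : P s`_k.
  by rewrite PE => L [_]; apply; rewrite /= mem_nth.
have /choice[e0 e0P] (k : 'I_(size s)) : exists e, 0 < e /\ P (p - e *: u k).
  have [_ [e ep Pe]] := Pmin _ (Ps k); exists e; split=> //.
  by rewrite /u -scalerN opprB.
(* A common step that works backwards along every [u k]; being at most 1, it also works forwards,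
   towards [s_k]. *)
pose e := \big[Num.min/1]_k e0 k.
have ep : 0 < e by apply: lt_bigmin => // k _; have [] := e0P k.
have e1 : e <= 1 by exact: bigmin_le_id.
have Pu (b : bool) (k : 'I_(size s)) : P (p + ((-1) ^+ b * e) *: u k).
  case: b; rewrite ?(expr0, expr1) ?mul1r ?mulN1r.
    rewrite scaleNr -scalerN opprB.
    apply: (@min_face_shrink _ _ _ _ _ (e0 k)) => //; last exact: bigmin_le.
      by rewrite -opprB scalerN; have [] := e0P k.
    exact: ltW.
  have -> : p + e *: u k = (1 - e) *: p + e *: s`_k.
    by apply/rowP => i; rewrite !mxE; ring.
  by move/convex_setP: cP; apply => //; exact: ltW.
(* By Cauchy-Schwarz the coefficients of [v] sum in absolute value to at most [ipnorm ip v * C]; the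
   1 keeps [C] positive. *)
pose C := 1 + \sum_(k < size s) ipnorm ip (g k).
have C0 : 0 < C by rewrite ltr_pwDl // sumr_ge0 // => k _; exact: ipnorm_ge0.
exists (e / C) => [|y yP yp]; first exact: divr_gt0.
set v := y - p in yp.
have vE : v = \sum_(k < size s) ip v (g k) *: u k.
  have [a [a1 ya]] : exists (a : nat -> R), \sum_(i < size s) a i = 1 /\
      y = \sum_(i < size s) a i *: s`_i.
    by apply: affine_hull_seq; rewrite -?PE //; apply: affine_hull_convex_hull;
      rewrite -PE.
  have va : v = \sum_(k < size s) a k *: u k.
    under eq_bigr do rewrite scalerBr.
    by rewrite sumrB -scaler_suml a1 scale1r -ya.
  (* The residual [f] is orthogonal to all [u k] and lies in their span, so it is 0. *)
  pose f := v - \sum_(k < size s) ip v (g k) *: u k.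
  apply/subr0_eq; rewrite -/f; apply: (@ip_eq0 _ _ ip).
  have fE : f = \sum_(k < size s) (a k - ip v (g k)) *: u k.
    by rewrite /f {1}va -sumrB; apply: eq_bigr => k _; rewrite scalerBl.
  rewrite {1}fE ip_suml big1 // => k _.
  by rewrite ipZl [ip (u k) _]ipC gP ?mulr0.
(* The sign of each coefficient is moved into the direction, leaving nonnegative weights. *)
have -> : y = p + \sum_(k < size s) (`|ip v (g k)| / e) *:
    (((-1) ^+ (ip v (g k) < 0)%R * e) *: u k).
  have -> : y = p + v by rewrite addrC subrK.
  rewrite {1}vE; congr (_ + _); apply: eq_bigr => k _.
  rewrite scalerA; congr (_ *: _).
  rewrite mulrACA; rewrite {1}[ip v (g k)]realEsign ?num_real //.
  by rewrite -[LHS]mulr1; field; rewrite gt_eqF.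
apply: convex_absorb => // [k|]; first by rewrite divr_ge0 // ltW.
rewrite -mulr_suml ler_pdivrMr // mul1r.
rewrite ltr_pdivlMr // in yp; apply: le_trans (ltW yp).
rewrite /C mulrDr mulr1 mulr_sumr ler_wpDl ?ipnorm_ge0 //.
by apply: ler_sum => k _; exact: cauchy_schwarz.
Qed.

End Nearest.

(** * The regularized path *)

Section RegularizedPath.
Context {R : realType} {d : nat}.
Variable ip : {dot 'rV[R]_d for idfun}.
Implicit Types (K P F S : set 'rV[R]_d) (x y z u v c : 'rV[R]_d).
Implicit Types (t delta : R).

Lemma argminP (f : 'rV[R]_d -> R) K x : K x -> (forall y, K y -> f x <= f y) ->
  K (argmin f K) /\ forall y, K y -> f (argmin f K) <= f y.
Proof.
move=> Kx xmin.
exact: (xgetPex 0 (ex_intro [set x | K x /\ forall y, K y -> f x <= f y] x _)).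
Qed.

Lemma proj0P P : polytope P -> P !=set0 -> P (proj ip P 0) /\
  forall y, P y -> ip (proj ip P 0) (proj ip P 0) <= ip y y.
Proof.
move=> polyP P0; have [x Px xmin] := polytope_nearest ip 0 polyP P0.
have [y Py|Pp pmin] := @argminP (fun y => ipnorm ip (y - 0)) P x Px.
  by rewrite ler_ipnorm xmin.
split=> // y /pmin; rewrite ler_ipnorm /proj.
by rewrite !subr0.
Qed.

(* The junk value of [proj] is 0, which is of minimal norm as well. *)
Lemma proj0_affine_hull_le F y : F (proj ip (affine_hull F) 0) ->
  affine_hull F y ->
  ip (proj ip (affine_hull F) 0) (proj ip (affine_hull F) 0) <= ip y y.
Proof.
move=> Fq Fy; rewrite /proj /argmin in Fq *.
set A := [set x | _] in Fq *.
have [[x Ax]|nA] := pselect (A !=set0); last first.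
  rewrite xgetPN ?ip0l ?ip_ge0 // => x Ax; apply: nA; by exists x.
have [_ /(_ y Fy)] := xgetPex 0 (ex_intro A x Ax).
by rewrite ler_ipnorm !subr0.
Qed.

Lemma proj0_affine_hull_ortho F y : F (proj ip (affine_hull F) 0) -> F y ->
  ip (proj ip (affine_hull F) 0) (y - proj ip (affine_hull F) 0) = 0.
Proof.
move=> Fq Fy; have := fun z => @proj0_affine_hull_le F z Fq.
set q := proj _ _ _ in Fq *; move=> qmin.
have aq := sub_affine_hull Fq; have ay := sub_affine_hull Fy.
have caff : @convex_set R 'rV[R]_d (affine_hull F).
  by apply/convex_setP => u v t _ _; exact: affine_hull_affine.
have q0 z : affine_hull F z -> 0 <= ip q (z - q).
  move=> az; rewrite -[X in ip X _]subr0.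
  apply: (nearest_ip_ge0 caff aq _ az) => w aw.
  by rewrite !subr0; exact: qmin.
(* Both [y] and its reflection [2q - y] lie in the affine hull, so the inequality holds with both
   signs. *)
have := q0 _ ay; have := q0 _ (affine_hull_affine (-1) aq ay).
by rewrite !ipE; lra.
Qed.

Lemma set_minE (A : set R) m : is_min A m -> set_min A = m.
Proof.
move=> [Am mA]; have [As sA] := xgetPex 0 (ex_intro (is_min A) m (conj Am mA)).
by apply/le_anti; rewrite sA // mA.
Qed.

Lemma delta_minE P : polytope P -> P !=set0 ->
  delta_min ip P = ipnorm ip (proj ip P 0).
Proof.
move=> polyP P0; have [Pp pmin] := proj0P polyP P0.
apply: set_minE; split=> [|t [t0 [x [Px xt]]]].
  by split; [exact: ipnorm_ge0|exists (proj ip P 0)].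
by rewrite (le_trans _ xt) // ler_ipnorm pmin.
Qed.

Lemma delta_min_ge0 P : polytope P -> P !=set0 -> 0 <= delta_min ip P.
Proof. by move=> polyP P0; rewrite delta_minE // ipnorm_ge0. Qed.

Lemma delta_min_le P x : polytope P -> P x -> delta_min ip P <= ipnorm ip x.
Proof.
move=> polyP Px; have P0 : P !=set0 by exists x.
by rewrite delta_minE // ler_ipnorm; apply: (proj0P polyP P0).2.
Qed.

Lemma polytope_argmin P c : polytope P -> P !=set0 ->
  exists x, P x /\ forall y, P y -> ip c x <= ip c y.
Proof.
move=> polyP [x0 Px0].
have [|x [Px _ xmin]] := @polytope_min_quadratic R d ip P c 0 0 0 0 polyP.
  by exists x0; rewrite ip0l mul0r addr0.
exists x; split=> // y Py; have := xmin _ Py.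
by rewrite ip0l !mul0r !addr0; apply.
Qed.

(** The path ends at the least-norm solution of the linear program, found by two successive
    minimizations. *)
Lemma delta_max_argmin P c : polytope P -> P !=set0 -> exists x,
  [/\ P x, forall y, P y -> ip c x <= ip c y, delta_max ip P c = ipnorm ip x &
   forall y, P y -> ip c y <= ip c x -> ipnorm ip x <= ipnorm ip y].
Proof.
move=> polyP P0; have [x0 [Px0 x0min]] := polytope_argmin c polyP P0.
have [|x [Px xx0 xmin]] :=
  @polytope_min_quadratic R d ip P 0 1 c 0 (ip c x0) polyP.
  by exists x0; rewrite mul0r addr0.
rewrite mul0r addr0 in xx0.
have xm y : P y -> ip c y <= ip c x -> ipnorm ip x <= ipnorm ip y.
  move=> Py yx; have := xmin y Py; rewrite ler_ipnorm !ip0l mul0r !add0r !mul1r.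
  by rewrite addr0; apply; exact: le_trans xx0.
have xc y : P y -> ip c x <= ip c y by move=> /x0min; exact: le_trans.
exists x; split=> //; apply: set_minE.
split=> [|t [t0 [m [[[y [Py yt] <-] _] [_ ym]]]]].
  split; first exact: ipnorm_ge0.
  exists (ip c x); split; split.
  - by exists x.
  - by move=> _ [y [Py _] <-]; exact: xc.
  - by exists x.
  - by move=> _ [y Py <-]; exact: xc.
by rewrite (le_trans _ yt) // xm // ym //; exists x.
Qed.

(** A relational form of [xdelta], which allows other candidates to be compared with the path
    point. *)
Definition optimal P c delta x := [/\ P x, ipnorm ip x <= delta &
  forall y, P y -> ipnorm ip y <= delta -> ip c x <= ip c y].

Lemma optimal_xdelta P c delta : polytope P -> P !=set0 ->
  delta_min ip P <= delta -> optimal P c delta (xdelta ip P c delta).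
Proof.
move=> polyP P0 dP; have [Pp _] := proj0P polyP P0.
have d0 : 0 <= delta by rewrite (le_trans _ dP) // delta_min_ge0.
have [|x [Px xd xmin]] :=
  @polytope_min_quadratic R d ip P c 0 0 1 (delta ^+ 2) polyP.
  exists (proj ip P 0); split=> //.
  by rewrite ip0l mul1r add0r -ipnorm_le // -delta_minE.
rewrite ip0l mul1r add0r -ipnorm_le // in xd.
have [|y [Py yd]|[Px' xd'] xmin'] := @argminP (ip c) (truncation ip P delta) x.
- by split.
- have := xmin y Py; rewrite ip0l add0r mul1r !mul0r !addr0 -ipnorm_le //.
  exact.
- by split=> // y Py yd; apply: xmin'.
Qed.

(** The norm constraint is slack at [w], so one can move slightly from [w] towards [y]; a better [y]
    would then improve on [x]. *)
Lemma optimal_slack P c delta x w y : @convex_set R 'rV[R]_d P -> 0 <= delta ->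
  optimal P c delta x -> P w -> ipnorm ip w < delta -> ip c w <= ip c x ->
  P y -> ip c x <= ip c y.
Proof.
move=> /convex_setP cP d0 [Px xd xmin] Pw; rewrite ipnorm_lt // => wd wx Py.
rewrite leNgt; apply/negP => yx.
pose a := ip w (y - w); pose b := ip (y - w) (y - w).
have b0 : 0 <= b := ip_ge0 ip _.
pose g := delta ^+ 2 - ip w w; have g0 : 0 < g by rewrite subr_gt0.
have a0 := normr_ge0 a.
(* The squared norm grows by at most [t * (2 * |a| + b)], which is at most [g]. *)
pose t := g / (g + 2 * `|a| + b).
have s0 : 0 < g + 2 * `|a| + b by lra.
have tE : t * (g + 2 * `|a| + b) = g by rewrite /t divfK // gt_eqF.
have t0 : 0 < t by rewrite divr_gt0.
have t1 : t <= 1 by rewrite ler_pdivrMr // mul1r; lra.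
have := xmin _ (cP _ _ _ (ltW t0) t1 Pw Py).
have -> : (1 - t) *: w + t *: y = w + t *: (y - w).
  by apply/rowP => i; rewrite !mxE; ring.
rewrite ipnorm_le // => h.
have {h} : ip c x <= ip c (w + t *: (y - w)).
  apply: h; rewrite ip_addZ -/a -/b.
  have at0 : t * a <= t * `|a| by rewrite ler_wpM2l ?ler_norm // ltW.
  have tb : t ^+ 2 * b <= t * b.
    by rewrite expr2 -mulrA ler_piMl // mulr_ge0 // ltW.
  have tg : 0 <= t * g by rewrite mulr_ge0 // ltW.
  by rewrite /g in tE tg *; lra.
by rewrite !ipE; nra.
Qed.

(** The midpoint of two distinct optimal points has norm below [delta]. By slackness it solves the
    whole linear program, against the minimality of [delta_max]. *)
Lemma optimal_unique P c delta x y : polytope P -> P !=set0 ->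
  delta <= delta_max ip P c ->
  optimal P c delta x -> optimal P c delta y -> x = y.
Proof.
move=> polyP P0 dmax ox oy; have [Px xd xmin] := ox; have [Py yd ymin] := oy.
have cP := polytope_convex polyP.
have d0 : 0 <= delta := le_trans (ipnorm_ge0 ip x) xd.
have cxy : ip c x = ip c y by apply/le_anti; rewrite xmin // ymin.
pose w := (1 - 2^-1) *: x + (2^-1 : R) *: y.
have Pw : P w by move/convex_setP: cP; apply=> //; lra.
have cw : ip c w = ip c x by rewrite /w !ipE -cxy; lra.
apply: (@ip_sub_eq0 _ _ ip); rewrite leNgt; apply/negP => xy.
have wd : ipnorm ip w < delta.
  move: xd yd xy; rewrite ipnorm_lt // !ipnorm_le // /w !ipE (ipC ip y x).
  move=> xd yd xy.
  lra.
have [z [Pz zmin dE zn]] := delta_max_argmin c polyP P0.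
have := zn w Pw; rewrite cw => /(_ (optimal_slack cP d0 ox Pw wd _ Pz)).
by rewrite cw lexx => /(_ isT); rewrite -dE; lra.
Qed.

Lemma xdelta_delta_max P c : polytope P -> P !=set0 ->
  let x := xdelta ip P c (delta_max ip P c) in
  [/\ delta_min ip P <= delta_max ip P c, P x,
      forall y, P y -> ip c x <= ip c y & ipnorm ip x = delta_max ip P c].
Proof.
move=> polyP P0 x.
have [z [Pz zmin dE zn]] := delta_max_argmin c polyP P0.
have dm : delta_min ip P <= delta_max ip P c by rewrite dE delta_min_le.
have [Px xd xmin] := optimal_xdelta c polyP P0 dm.
have xz : ip c x <= ip c z by apply: xmin; rewrite ?dE.
split=> // [y Py|]; first exact: le_trans xz (zmin y Py).
by apply/le_anti; rewrite xd {1}dE zn.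
Qed.

(* Perturb [v] towards [p], then move from [q] slightly towards the result: the
   norm decreases. *)
Lemma optimal_tangent P c delta q p v : @convex_set R 'rV[R]_d P ->
  optimal P c delta q -> P p -> ip q (p - q) < 0 -> P v -> ip q (v - q) <= 0 ->
  ip c q <= ip c v.
Proof.
move=> /convex_setP cP [Pq qd qmin] Pp pq Pv vq.
have key w : P w -> ip q (w - q) < 0 -> ip c q <= ip c w.
  move=> Pw wq; pose b := ip (w - q) (w - q); set a := ip q _ in wq.
  have b0 : 0 <= b := ip_ge0 ip _.
  have ba : 0 < b - a by lra.
  pose t := - a / (b - a).
  have t0 : 0 < t by rewrite divr_gt0 ?oppr_gt0.
  have t1 : t <= 1 by rewrite ler_pdivrMr // mul1r; lra.
  have tE : t * (b - a) = - a by rewrite /t divfK ?gt_eqF.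
  have := qmin _ (cP _ _ _ (ltW t0) t1 Pq Pw).
  have -> : (1 - t) *: q + t *: w = q + t *: (w - q).
    by apply/rowP => i; rewrite !mxE; ring.
  move=> h; have {h} : ip c q <= ip c (q + t *: (w - q)).
    apply: h; apply: le_trans qd; rewrite ler_ipnorm.
    rewrite ip_addZ -/a -/b -addrA gerDl.
    have -> : 2 * t * a + t ^+ 2 * b = t * (2 * a + t * b) by ring.
    by rewrite pmulr_rle0 //; nra.
  by rewrite !ipE; nra.
(* Halved to match the factor 2 in [ge0_of_quadratic]. *)
pose a := (ip c v - ip c q) / 2; suff : 0 <= a by rewrite /a; lra.
apply: (ge0_of_quadratic (normr_ge0 (ip c (p - v)))) => t t0 t1.
have : ip c q <= ip c ((1 - t) *: v + t *: p).
  apply: key; first by apply: cP => //; exact: ltW.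
  move: pq vq; rewrite !ipE => pq vq.
  have : 0 <= (1 - t) * (ip q q - ip q v) by rewrite mulr_ge0; lra.
  have : 0 < t * (ip q q - ip q p) by rewrite mulr_gt0; lra.
  by lra.
have tn : t * ip c (p - v) <= t * `|ip c (p - v)|.
  by rewrite ler_wpM2l ?ler_norm // ltW.
have -> : 2 * t * a + t ^+ 2 * `|ip c (p - v)| =
  t * (ip c v - ip c q + t * `|ip c (p - v)|) by rewrite /a; field.
move=> h; rewrite pmulr_rge0 //.
apply: le_trans (_ : ip c v - ip c q + t * ip c (p - v) <= _); last by lra.
by move: h; rewrite !ipE; lra.
Qed.

(** Continuity of the path. By the parallelogram identity, if [x] and [z] were further apart, their
    midpoint would have norm at most [delta] and cost at most that of [x]; by uniqueness it would be
    [x], forcing [x = z]. *)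
Lemma optimal_dist P c delta delta' x z : @convex_set R 'rV[R]_d P ->
  (forall y, optimal P c delta y -> x = y) -> optimal P c delta x ->
  delta <= delta' -> P z -> ipnorm ip z <= delta' -> ip c z <= ip c x ->
  ip (x - z) (x - z) <= 2 * (delta' ^+ 2 - delta ^+ 2).
Proof.
move=> /convex_setP cP uniq [Px xd xmin] dd' Pz zd' zx.
have d0 : 0 <= delta := le_trans (ipnorm_ge0 ip x) xd.
have d'0 : 0 <= delta' := le_trans d0 dd'.
have dd2 : delta ^+ 2 <= delta' ^+ 2 by rewrite ler_sqr.
rewrite leNgt; apply/negP => xz.
pose w := (1 - 2^-1) *: x + (2^-1 : R) *: z.
have Pw : P w by apply: cP => //; lra.
have wd : ipnorm ip w <= delta.
  move: xd zd' xz; rewrite !ipnorm_le // /w !ipE (ipC ip z x) => xd zd xz.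
  lra.
have cw : ip c w <= ip c x by rewrite /w !ipE; lra.
have xw : x = w.
  by apply: uniq; split=> // y Py yd; apply: le_trans cw (xmin y Py yd).
have : x - z = 0.
  have -> : x - z = 2 *: (x - w).
    by apply/rowP => i; rewrite /w !mxE; field.
  by rewrite -xw subrr scaler0.
by move=> e; rewrite e ip0l in xz; lra.
Qed.

(* Along the part of the path whose minimal face is [G], the path follows the
   line through the projection [q] of 0 onto the affine hull of [G]; hence an
   earlier path point [x0] of [G] lies in the open segment from [q] to [x1],
   unless [x0 = q]. *)
Lemma optimal_face P c F delta0 delta1 x0 x1 p q : polytope P ->
  delta0 < delta1 -> delta1 <= delta_max ip P c ->
  optimal P c delta0 x0 -> optimal P c delta1 x1 -> min_face P x1 x0 ->
  min_face P x1 q -> ip q (x0 - q) = 0 -> ip q (x1 - q) = 0 ->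
  P p -> (forall y, P y -> ip p p <= ip y y) -> P `<=` min_face P p ->
  face P F -> F x0 -> F x1.
Proof.
move=> polyP d01 d1max o0 o1 [_ _] [Pq [e e0 Pe]] q0 q1 Pp pmin pri fF Fx0.
have [Px0 x0d x0min] := o0; have [Px1 x1d x1min] := o1.
have cP := polytope_convex polyP; have P0 : P !=set0 by exists p.
have d0 : 0 <= delta0 := le_trans (ipnorm_ge0 ip x0) x0d.
have d1 : 0 <= delta1 by lra.
have x0d1 : ipnorm ip x0 <= delta1 by exact: le_trans x0d (ltW d01).
have [<-//|/eqP x01] := eqVneq x0 x1.
have c10 : ip c x1 <= ip c x0 by exact: x1min.
have c10' : ip c x1 < ip c x0.
  rewrite ltNge; apply/negP => c01; apply: x01.
  apply: (optimal_unique polyP P0 d1max _ o1); split=> // y Py yd.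
  exact: le_trans c01 (x1min y Py yd).
have x1d0 : delta0 < ipnorm ip x1.
  rewrite ltNge; apply/negP => x1d0; apply: x01.
  apply: (optimal_unique polyP P0 _ o0); first by lra.
  by split=> // y Py yd; apply: le_trans c10 (x0min y Py yd).
have [x0q|x0q] := eqVneq x0 q.
  have [x0p|x0p] := eqVneq x0 p.
    by apply: (min_face_sub cP fF Fx0); rewrite x0p; exact: pri.
  have pq : ip q (p - q) < 0.
    have := pmin _ Pq; have : 0 < ip (q - p) (q - p).
      by apply: neq0_dnorm_gt0; rewrite subr_eq0 -x0q.
    by rewrite !ipE (ipC ip p q); lra.
  rewrite x0q in o0 c10'.
  (* [x1] is in the tangent halfspace at [q = x0], so it cannot cost less than [x0]. *)
  have := optimal_tangent cP o0 Pp pq Px1; rewrite q1 lexx => /(_ isT).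
  by rewrite leNgt c10'.
pose a := ip (x0 - q) (x0 - q); pose b := ip (x1 - q) (x1 - q).
have a0 : 0 < a by apply: neq0_dnorm_gt0; rewrite subr_eq0.
have x0E : ip x0 x0 = ip q q + a.
  by move: q0; rewrite /a !ipE (ipC ip x0 q); lra.
have x1E : ip x1 x1 = ip q q + b.
  by move: q1; rewrite /b !ipE (ipC ip x1 q); lra.
have ab : a < b.
  have x0d2 : ip x0 x0 <= delta0 ^+ 2 by rewrite -ipnorm_le.
  have : delta0 ^+ 2 < ip x1 x1 by rewrite ltNge -ipnorm_le // -ltNge.
  by lra.
have b0 : 0 < b by lra.
(* The ratio of the distances of [x0] and [x1] from [q]: the homothetic image [w] of [x1] has the
   same norm as [x0]. *)
pose t := Num.sqrt (a / b).
have t0 : 0 < t by rewrite sqrtr_gt0 divr_gt0.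
have t2 : t ^+ 2 * b = a.
  by rewrite sqr_sqrtr ?divfK ?gt_eqF // divr_ge0 ?ltW.
have t1 : t < 1.
  rewrite -(@ltr_pXn2r _ 2) ?nnegrE ?(ltW t0) // expr1n.
  by rewrite -(ltr_pM2r b0) t2 mul1r.
pose w := (1 - t) *: q + t *: x1.
have wE : w = q + t *: (x1 - q) by apply/rowP => i; rewrite !mxE; ring.
have Pw : P w by move/convex_setP: cP; apply=> //; exact: ltW.
have wd : ipnorm ip w <= delta0.
  apply: le_trans x0d; rewrite ler_ipnorm x0E wE ip_addZ q1 -/b t2.
  by rewrite mulr0 addr0.
(* Since [(1 - m) * e = m], the point [y = x1 + m (x0 - w)] is a convex combination of [x0] and a
   prolongation of [[q, x1]] beyond [x1]. Comparing [y] with [x1] gives [ip c w <= ip c x0]. *)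
pose m := e / (e + 1).
have e1 : 0 < e + 1 by lra.
have m0 : 0 < m by rewrite divr_gt0.
have m1 : m < 1 by rewrite ltr_pdivrMr //; lra.
have mE : m * (e + 1) = e by rewrite /m divfK // gt_eqF.
pose y := x1 + (m *: (x0 - x1) + (m * (1 - t)) *: (x1 - q)).
have Py : P y.
  have -> : y = (1 - m) *: (x1 + (e * (1 - t)) *: (x1 - q)) + m *: x0.
    by apply/rowP => i; rewrite /y /m !mxE; field; rewrite gt_eqF.
  move/convex_setP: (cP); apply=> //; try exact: ltW.
  by apply: (min_face_shrink cP Px1 Pe); nra.
have yd : ipnorm ip y <= delta1.
  apply: le_trans x1d; rewrite ler_ipnorm x1E.
  (* The weights [1 - m * t] and [m], applied to lengths in the ratio [1 : t], give at most the
     length of [x1 - q]. *)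
  have -> : y = q + 1 *: ((1 - m * t) *: (x1 - q) + m *: (x0 - q)).
    by apply/rowP => i; rewrite /y !mxE; ring.
  rewrite ip_addZ (ipDr ip _ _ q) !(ipZr ip _ _ q) q0 q1.
  rewrite ip_addZ !ipZl ipZr -/a -/b.
  have := ip_ge0 ip (- (x0 - q) + t *: (x1 - q)).
  rewrite ip_addZ !(ipNl _ (x0 - q)) ipNr opprK (ipC ip (x0 - q)).
  rewrite -/a -/b -t2 => h.
  have uv : ip (x1 - q) (x0 - q) <= t * b by nra.
  have s0 : 0 <= (1 - m * t) * m by rewrite mulr_ge0; nra.
  have := ler_wpM2l s0 uv; nra.
have cy := x1min y Py yd.
have cw : ip c w <= ip c x0.
  have : 0 <= m * (ip c (x0 - x1) + (1 - t) * ip c (x1 - q)).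
    by move: cy; rewrite /y !ipE; lra.
  by rewrite pmulr_rge0 // wE !ipE; lra.
have x0w : x0 = w.
  apply: (optimal_unique polyP P0 _ o0); first by lra.
  by split=> // z Pz zd; apply: le_trans cw (x0min z Pz zd).
rewrite x0w in Fx0.
exact: (face_endpoints cP fF Pq Px1 t0 t1 Fx0).2.
Qed.

End RegularizedPath.

(** * Monotonicity *)

Lemma monotone_of_faces (R : realType) (d : nat) (ip : {dot 'rV[R]_d for idfun})
    (P : set 'rV[R]_d) : polytope P -> P !=set0 ->
  relint ip P (proj ip P 0) ->
  (forall F : set 'rV[R]_d, face P F -> F !=set0 ->
     F (proj ip (affine_hull F) 0)) ->
  monotone ip P.
Proof.
move=> polyP P0 [_ [r0 r00 r0P]] projF c F fF d0 d1 dmin d01 dmax Fx0.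
have cP := polytope_convex polyP.
have [Pp pmin] := proj0P ip polyP P0; set p := proj ip P 0 in r0P Pp pmin.
have pri : P `<=` min_face P p.
  move=> z Pz; split=> //; pose n := ipnorm ip (p - z).
  have n0 : 0 <= n := ipnorm_ge0 ip _.
  pose e := r0 / (n + 1) / 2.
  have e0 : 0 < e by rewrite !divr_gt0 // ltr_wpDl.
  exists e => //; apply: r0P.
    have -> : p + e *: (p - z) = (1 - (- e)) *: p + (- e) *: z.
      by apply/rowP => i; rewrite !mxE; ring.
    by apply: affine_hull_affine; exact: sub_affine_hull.
  have -> : p + e *: (p - z) - p = e *: (p - z).
    by apply/rowP => i; rewrite !mxE; ring.
  rewrite ipnorm_lt ?(ltW r00) // ipZl ipZr -sqr_ipnorm -/n.
  have eE : e * (n + 1) = r0 / 2.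
    by rewrite /e; field; rewrite gt_eqF // ltr_wpDl.
  have en : 0 <= e * n by rewrite mulr_ge0 // ltW.
  nra.
pose x t := xdelta ip P c t.
have opt t : d0 <= t -> optimal ip P c t (x t).
  by move=> dt; apply: optimal_xdelta => //; exact: le_trans dt.
have near s t : d0 <= s -> s <= t -> t <= d1 ->
    ip (x s - x t) (x s - x t) <= 2 * (t ^+ 2 - s ^+ 2).
  move=> ds st td; have os := opt s ds.
  have [|Pt xt tmin] := opt t; first exact: le_trans st.
  have sd : s <= delta_max ip P c by lra.
  apply: (optimal_dist cP _ os st Pt xt).
    by move=> y; exact: optimal_unique.
  by have [Ps xs _] := os; apply: tmin => //; exact: le_trans st.
have d0_ge0 : 0 <= d0 by apply: le_trans dmin; exact: delta_min_ge0.
apply: contrapT => nFx1.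
(* The last parameter in [F] is reached by continuity, then passed, which is absurd. *)
pose T : set R := [set t | [/\ d0 <= t, t <= d1 & F (x t)]].
have Td0 : T d0 by split.
have supT : has_sup T.
  by split; [exists d0|exists d1 => t []].
set s := sup T.
have ds : d0 <= s by apply: ub_le_sup => //; exact: supT.2.
have sd : s <= d1 by apply: ge_sup; [exists d0|move=> t []].
have [r r_gt0 rP] := face_nearby ip (x s) polyP.
have d1_ge0 : 0 <= d1 by lra.
(* Over a parameter interval of length [h] the squared displacement is at most [4 * d1 * h < r]. *)
pose h := r / (4 * d1 + 4).
have h0 : 0 < h by rewrite divr_gt0 //; lra.
have hE : h * (4 * d1 + 4) = r by rewrite /h divfK // gt_eqF //; lra.
have close a b : 0 <= a -> a <= b -> b <= d1 -> b <= a + h ->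
    2 * (b ^+ 2 - a ^+ 2) < r.
  move=> a0 ab bd bah; have : (b - a) * (b + a) <= h * (2 * d1).
    by apply: ler_pM; lra.
  by lra.
have Fxs : F (x s).
  have [t [dt td Fxt] st] := sup_adherent h0 supT; rewrite -/s in st.
  apply: (rP F (x t)) => //.
  have ts : t <= s by apply: ub_le_sup => //; exact: supT.2.
  apply: le_lt_trans (near t s dt ts sd) _.
  by apply: close; lra.
have s_lt : s < d1.
  by rewrite lt_neqAle sd andbT; apply/eqP => sE; apply: nFx1; rewrite -sE.
pose t := Num.min d1 (s + h).
have st : s < t by rewrite lt_min s_lt ltrDl.
have td : t <= d1 by rewrite ge_min lexx.
have th : t <= s + h by rewrite ge_min lexx orbT.
have dt : d0 <= t by lra.
have [Pxt _ _] := opt t dt.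
have fG := polytope_min_face ip polyP Pxt.
have Gxt := min_face_self Pxt.
(* The same radius [r] now serves for the minimal face of the later point. *)
have Gxs : min_face P (x t) (x s).
  apply: (rP _ (x t)) => //.
  have -> : x t - x s = - (x s - x t) by rewrite opprB.
  rewrite ipNl ipNr opprK; apply: le_lt_trans (near s t ds (ltW st) td) _.
  by apply: close => //; lra.
have Gq := projF _ fG (ex_intro _ _ Gxt).
have Fxt : F (x t).
  apply: (optimal_face polyP st _ (opt s ds) (opt t dt) Gxs Gq
    _ _ Pp pmin pri fF) => //.
  - by lra.
  - exact: proj0_affine_hull_ortho.
  - exact: proj0_affine_hull_ortho.
have : t <= s by apply: ub_le_sup; [exact: supT.2|split].
by lra.
Qed.

Lemma relint_of_monotone (R : realType) (d : nat)
    (ip : {dot 'rV[R]_d for idfun}) (P : set 'rV[R]_d) :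
  polytope P -> P !=set0 -> monotone ip P -> relint ip P (proj ip P 0).
Proof.
move=> polyP P0 mono; have [Pp pmin] := proj0P ip polyP P0.
set p := proj ip P 0 in Pp pmin *.
have cP := polytope_convex polyP.
apply: relint_min_face => // z Pz; apply: contrapT => nFz.
have fF := polytope_min_face ip polyP Pp.
have polyF := face_polytope polyP fF.
have Fp := min_face_self Pp.
(* The cost [y - z] separates [z] from the minimal face [F] of [p]: it is larger on all of [F] than
   at [z]. Yet the path, starting at [p], must end in [F] at a minimizer over [P]. *)
have [y Fy ymin] := polytope_nearest ip z polyF (ex_intro _ _ Fp).
have [c cE] : exists c, c = y - z by eexists.
have [dm Px xmin _] := xdelta_delta_max ip c polyP P0.
have d_min := optimal_xdelta (ip := ip) c polyP P0 (lexx _).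
have p_min : xdelta ip P c (delta_min ip P) = p.
  have [Pm md _] := d_min; rewrite delta_minE // ler_ipnorm -/p in md.
  have := nearest_ip_ge0 (ip := ip) (z := 0) cP Pp _ Pm.
  rewrite !subr0 => pm; apply: (@ip_sub_eq0 _ _ ip).
  have {pm} : 0 <= ip p (xdelta ip P c (delta_min ip P) - p).
    by apply: pm => w /pmin; rewrite !subr0.
  by rewrite delta_minE // -/p !ipE (ipC ip _ p) in md *; lra.
have Fx : min_face P p (xdelta ip P c (delta_max ip P c)).
  by apply: (mono c _ fF (delta_min ip P)) => //; rewrite p_min.
have cF : @convex_set R 'rV[R]_d (min_face P p) by case: fF.
have := nearest_ip_ge0 cF Fy ymin Fx; have := xmin z Pz.
have ccE : ip c c = ip c y - ip c z by rewrite [X in ip _ X]cE ipDr ipNr.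
have : 0 < ip (y - z) (y - z).
  apply: neq0_dnorm_gt0; rewrite subr_eq0; apply/eqP => yz.
  by apply: nFz; rewrite -yz.
by rewrite -cE ccE ipDr ipNr; lra.
Qed.

Lemma proj_affine_hull_of_monotone (R : realType) (d : nat)
    (ip : {dot 'rV[R]_d for idfun}) (P F : set 'rV[R]_d) :
  polytope P -> monotone ip P -> face P F -> F !=set0 ->
  F (proj ip (affine_hull F) 0).
Proof.
move=> polyP mono fF F0; have polyF := face_polytope polyP fF.
have P0 : P !=set0 by case: F0 => y /(face_sub fF) Py; exists y.
have cF := polytope_convex polyF.
have [x Fx] := polytope_nearest ip 0 polyF F0.
rewrite subr0 => xmin.
have x0 y : F y -> 0 <= ip x (y - x).
  move=> Fy; have := nearest_ip_ge0 (ip := ip) (z := 0) cF Fx _ Fy.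
  by rewrite subr0; apply => z /xmin.
have [xF|] := pselect (forall y, F y -> ip x (y - x) = 0).
  have qmin y : affine_hull F y -> ipnorm ip (x - 0) <= ipnorm ip (y - 0).
    move=> /(affine_hull_ip_eq0 xF) xy; rewrite !subr0 ler_ipnorm.
    by have := ip_ge0 ip (y - x); move: xy; rewrite !ipE (ipC ip y x); lra.
  (* The chosen minimizer [w] has norm at most that of [x], and [w - x] is orthogonal to [x]; hence
     [w = x]. *)
  have [aw /(_ x (sub_affine_hull Fx))] := argminP (sub_affine_hull Fx) qmin.
  have := affine_hull_ip_eq0 xF aw; rewrite -/(proj ip (affine_hull F) 0).
  set w := proj _ _ _; rewrite ler_ipnorm !subr0 => xw wx.
  suff -> : w = x by [].
  apply: (@ip_sub_eq0 _ _ ip); move: xw.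
  by rewrite !ipE (ipC ip w x); lra.
move=> /existsNP[y /not_implyP[Fy yx]].
have {}yx : 0 < ip x (y - x) by rewrite lt_def x0 // andbT; apply/eqP.
have Px := face_sub fF Fx; have Py := face_sub fF Fy.
have fH : face F [set z | F z /\ ip x (z - x) = 0].
  by apply: face_argmin => // u v; exact: polytope_endpoints.
pose c := - x.
have [dm Pz zmin zd] := xdelta_delta_max ip c polyP P0.
set z := xdelta ip P c _ in Pz zmin zd.
have xz : ip x y <= ip x z by have := zmin y Py; rewrite /c !ipNl; lra.
have xn : ipnorm ip x <= delta_max ip P c.
  rewrite -zd ler_ipnorm; have := ip_ge0 ip (z - x).
  by move: yx; rewrite !ipE (ipC ip z x); lra.
(* In the ball of radius [ipnorm ip x], only [x] itself attains [ip x x] as the value of [ip x]. *)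
have xx : xdelta ip P c (ipnorm ip x) = x.
  have [_ wd /(_ x Px (lexx _))] :=
    optimal_xdelta c polyP P0 (delta_min_le ip polyP Px).
  move: wd; rewrite ler_ipnorm; set w := xdelta _ _ _ _ => wd.
  rewrite /c !ipNl => xw; apply: (@ip_sub_eq0 _ _ ip).
  by rewrite !ipE (ipC ip w x); lra.
(* Monotonicity would give [ip x (z - x) = 0], although [ip x z >= ip x y > ip x x]. *)
have := mono c _ (face_trans fF fH) _ _ (delta_min_le ip polyP Px) xn (lexx _).
rewrite xx => /(_ _)[|_]; first by split=> //; rewrite subrr ip0r.
by rewrite -/z; move: yx; rewrite !ipE; lra.
Qed.

Theorem theorem3p2 (R : realType) (d : nat) (ip : {dot 'rV[R]_d for idfun})
    (P : set 'rV[R]_d) (P0 : P !=set0) (polyP : polytope P) :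
  monotone ip P <->
  relint ip P (proj ip P 0) /\
  (forall F : set 'rV[R]_d, face P F -> F !=set0 ->
     F (proj ip (affine_hull F) 0)).
Proof.
split=> [mono|[pri projF]]; last exact: monotone_of_faces.
split; first exact: relint_of_monotone.
by move=> F; exact: proj_affine_hull_of_monotone.
Qed.
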